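(* Let $a_1,a_2,a_3,a_4$ be real numbers and let $\alpha\in\mathbb{C}$. Then the finite system of Wilson polynomials $$p_k(1-a_1,1-a_2,1-a_3,1-a_4;s^2),\qquad k\ge 0\text{ an integer with }4k<a_1+a_2+a_3+a_4-3,$$ is orthogonal with respect to the discrete Dougall weight, which, in the variable $s$ given by $is=\alpha+n$ (so $s^2=-(\alpha+n)^2$), assigns to $n\in\mathbb{Z}$ the mass $$c_n=\frac{\alpha+n}{\prod_{j=1}^4\Gamma(a_j+\alpha+n)\Gamma(a_j-\alpha-n)} .$$ That is, for all nonnegative integers $k\ne l$ with $4k<a_1+a_2+a_3+a_4-3$ and $4l<a_1+a_2+a_3+a_4-3$, $$\sum_{n=-\infty}^{\infty}c_n\,p_k\bigl(1-a_1,1-a_2,1-a_3,1-a_4;-(\alpha+n)^2\bigr)\,p_l\bigl(1-a_1,1-a_2,1-a_3,1-a_4;-(\alpha+n)^2\bigr)=0 .$$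
   Context: $(x)_k=x(x+1)\cdots(x+k-1)$, $(x)_0=1$. The weight may be sign-indefinite; orthogonality means vanishing of the bilinear expression. $1/\Gamma$ is the entire reciprocal gamma function. The Wilson polynomials, as polynomials in $s^2$, are $$p_n(a,b,c,d;s^2)=(a+b)_n(a+c)_n(a+d)_n\;{}_4F_3\!\left[\begin{matrix}-n,\ n+a+b+c+d-1,\ a+is,\ a-is\\ a+b,\ a+c,\ a+d\end{matrix};1\right],$$ i.e. $$p_n(a,b,c,d;s^2)=\sum_{k=0}^n\frac{(-n)_k(n+a+b+c+d-1)_k(a+is)_k(a-is)_k}{k!}\,(a+b+k)_{n-k}(a+c+k)_{n-k}(a+d+k)_{n-k},$$ where $(a+is)_k(a-is)_k=\prod_{j=0}^{k-1}\bigl((a+j)^2+s^2\bigr)$. *)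

(* Defs.v *)
From Stdlib Require Import Reals ZArith Factorial.
From Coquelicot Require Import Coquelicot.

Open Scope C_scope.

Fixpoint Cprod (f : nat -> C) (k : nat) : C :=
  match k with
  | O => 1
  | S j => Cprod f j * f j
  end.

Definition Cpoch (x : C) (k : nat) : C := Cprod (fun j => x + INR j) k.

Definition Cexp (z : C) : C :=
  ((exp (Re z) * cos (Im z))%R, (exp (Re z) * sin (Im z))%R).

(* The limit of a complex sequence, taken componentwise; meaningful only when
   the sequence converges. *)
Definition Clim_seq (u : nat -> C) : C :=
  (real (Lim_seq (fun n => Re (u n))), real (Lim_seq (fun n => Im (u n)))).

(* The entire function 1/Gamma, by Gauss's formula
     1/Gamma(z) = lim_n z (z+1) ... (z+n) / (n! n^z),
   whose limit exists at every complex z and is 0 at z = 0, -1, -2, ...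
   Here n^(-z) is exp (- z ln n), with the real logarithm. *)
Definition rGamma (z : C) : C :=
  Clim_seq (fun n => Cpoch z (S n) / INR (fact n) * Cexp (- z * ln (INR n))).

(* The Wilson polynomial p_n(a,b,c,d;t) in the variable t = s^2; the product
   over j is (a+is)_k (a-is)_k. *)
Definition wilson (n : nat) (a b c d t : C) : C :=
  sum_n (fun k =>
    Cpoch (- INR n) k * Cpoch (INR n + a + b + c + d - 1) k
    * Cprod (fun j => (a + INR j) ^ 2 + t) k / INR (fact k)
    * (Cpoch (a + b + INR k) (n - k)
       * Cpoch (a + c + INR k) (n - k)
       * Cpoch (a + d + INR k) (n - k))) n.

Definition dougall_weight (a1 a2 a3 a4 : R) (alpha : C) (n : Z) : C :=
  let z := alpha + IZR n in
  z * (rGamma (a1 + z) * rGamma (a1 - z))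
    * (rGamma (a2 + z) * rGamma (a2 - z))
    * (rGamma (a3 + z) * rGamma (a3 - z))
    * (rGamma (a4 + z) * rGamma (a4 - z)).

(* Convergence of a bilateral series: the sums over n >= 0 and over n < 0
   converge separately. *)
Definition is_bilateral_series (f : Z -> C) (l : C) : Prop :=
  exists lp lm : C,
    is_series (fun n : nat => f (Z.of_nat n)) lp /\
    is_series (fun n : nat => f (- Z.of_nat (S n))%Z) lm /\
    l = lp + lm.

(* Main.v *)
Require Import Defs.
From Stdlib Require Import Reals ZArith Lra Lia Factorial.
From Coquelicot Require Import Coquelicot.

Open Scope C_scope.

(** The Wilson polynomials are eigenfunctions of a second order difference
    operator that is formally self-adjoint for the Dougall weight, so their
    orthogonality is a Sturm-Liouville argument: no bilateral hypergeometric
    sum has to be evaluated.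

    Write z = alpha + n, b_j = 1 - a_j, Y_k(z) = p_k(b_1,...,b_4; -z^2),
    g_a(z) = 1 / (Gamma(a+z) Gamma(a-z)), so that c_n = w(z) with
    w(z) = z g_{a_1}(z) ... g_{a_4}(z). As Y_k is even, Y_k(z+1) - Y_k(z) is
    divisible by (z+1)^2 - z^2 = 2z+1; let DY_k be the quotient, which is again
    a polynomial. Expressing the operator through DY_k keeps the factors 2z+1
    and 2z-1 out of the denominators of its coefficients, where they would
    vanish at some z when alpha is half an odd integer. With
    G(z) = prod_j (b_j + z) g_{a_j}(z) and lambda_k = k (k + sum_j b_j - 1),
    the difference equation reads
      2 lambda_k w(z) Y_k(z) = G(z) DY_k(z) - G(z-1) DY_k(z-1):
    it follows from [wil_difference], which is checked on the basis
    (b_1+z)_i (b_1-z)_i, and from the functional equation of 1/Gamma, which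
    gives G(z-1) = prod_j (b_j - z) g_{a_j}(z) ([gfac_pred]). Hence
    ([lagrange_identity]) the Casoratian S = G (Y_l DY_k - Y_k DY_l) satisfies
      2 (lambda_k - lambda_l) w Y_k Y_l (z) = S(z) - S(z-1),
    and the bilateral series telescopes. It remains to see that S(alpha + n)
    tends to 0 as n tends to +oo and to -oo. The symmetry S(-1-z) = S(z) reduces
    the second limit to the first one for - alpha. For the first limit, G
    satisfies a first order recursion whose ratio is rational in z, and Raabe's
    test shows that G(alpha + n) decays like n^(8 - 2 (a_1 + ... + a_4))
    ([gweight_bound]), while the other factor of S is at most of order
    n^(2k + 2l). As k and l are distinct, one of them is at least 1, so that the
    sum of the a_j exceeds 7, and the hypotheses on k and l make the total
    exponent smaller than -1. The same hypotheses give lambda_k <> lambda_l.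

    The only property of 1/Gamma that enters is
    1/Gamma(z) = z / Gamma(z+1) ([rGamma_shift]). It rests on the convergence of
    Gauss's product at every complex z ([gauss_cv]), proved from the fact that
    the quotient of consecutive terms is 1 + O(1/n^2). *)

(** * The reciprocal Gamma function *)

Lemma exp_mono (x y : R) : (x <= y)%R -> (exp x <= exp y)%R.
Proof. intros [H|H]; [left; now apply exp_increasing|rewrite H; apply Rle_refl]. Qed.

Lemma exp_taylor1 (x : R) : (0 <= exp x - 1 - x <= x ^ 2 * exp (Rabs x))%R.
Proof.
  pose proof (exp_ineq1_le x) as H1.
  pose proof (exp_ineq1_le (- x)) as H2.
  pose proof (exp_pos x) as H3.
  assert (E : (exp x * exp (- x) = 1)%R)
    by (rewrite <- exp_plus, Rplus_opp_r; apply exp_0).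
  (* e^x - 1 <= x e^x, from 1 - x <= e^(-x) *)
  assert (H4 : (exp x - 1 <= x * exp x)%R) by nra.
  split; [lra|].
  destruct (Rle_dec 0 x) as [Hx|Hx].
  - rewrite Rabs_pos_eq by exact Hx. nra.
  - (* x (e^x - 1) <= x^2 here, as e^x >= 1 + x *)
    rewrite Rabs_left by lra.
    assert (1 <= exp (- x))%R by lra.
    nra.
Qed.

Lemma exp_minus_1_bound (x : R) : (Rabs (exp x - 1) <= Rabs x * exp (Rabs x))%R.
Proof.
  pose proof (exp_ineq1_le x) as H1.
  pose proof (exp_ineq1_le (- x)) as H2.
  pose proof (exp_pos x) as H3.
  assert (E : (exp x * exp (- x) = 1)%R)
    by (rewrite <- exp_plus, Rplus_opp_r; apply exp_0).
  destruct (Rle_dec 0 x) as [Hx|Hx].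
  - rewrite (Rabs_pos_eq x) by exact Hx. rewrite Rabs_pos_eq by lra. nra.
  - rewrite (Rabs_left x) by lra.
    assert (exp x <= 1)%R by nra.
    rewrite Rabs_left1 by lra. nra.
Qed.

Lemma one_minus_cos (y : R) : (1 - cos y = 2 * sin (y / 2) ^ 2)%R.
Proof.
  replace y with (2 * (y / 2))%R at 1 by field.
  rewrite cos_2a_sin. ring.
Qed.

Lemma Rabs_sin_le (y : R) : (Rabs (sin y) <= Rabs y)%R.
Proof.
  destruct (MVT_gen sin 0 y cos) as [c [_ Hc]].
  - intros x _. auto_derive; [exact I|ring].
  - intros x _. apply continuity_sin.
  - rewrite sin_0, !Rminus_0_r in Hc. rewrite Hc, Rabs_mult.
    pose proof (COS_bound c) as B.
    assert (Rabs (cos c) <= 1)%R by (apply Rabs_le; lra).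
    pose proof (Rabs_pos y). nra.
Qed.

Lemma cos_taylor (y : R) : (0 <= 1 - cos y <= y ^ 2)%R.
Proof.
  rewrite one_minus_cos.
  pose proof (Rabs_sin_le (y / 2)) as H.
  apply Rsqr_le_abs_1 in H. unfold Rsqr in H. nra.
Qed.

(** The mean value theorem for sin t - t, with
    |cos c - 1| <= 2 |sin (c/2)| <= |c|. *)
Lemma sin_taylor (y : R) : (Rabs (sin y - y) <= y ^ 2)%R.
Proof.
  destruct (MVT_gen (fun t => sin t - t)%R 0 y (fun t => cos t - 1)%R)
    as [c [Hc1 Hc]].
  - intros x _. auto_derive; [exact I|ring].
  - intros x _. apply continuity_pt_minus; [apply continuity_sin|].
    apply continuity_pt_id.
  - rewrite sin_0, !Rminus_0_r in Hc. rewrite Hc, Rabs_mult.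
    assert (A : (Rabs (cos c - 1) <= Rabs y)%R).
    { rewrite Rabs_minus_sym, one_minus_cos.
      pose proof (Rabs_sin_le (c / 2)) as H.
      assert (Rabs (sin (c / 2)) <= 1)%R
        by (apply Rabs_le; pose proof (SIN_bound (c / 2)); lra).
      pose proof (Rabs_pos (sin (c / 2))).
      rewrite <- pow2_abs, Rabs_pos_eq by nra.
      assert (E : (Rabs (c / 2) = Rabs c / 2)%R)
        by (unfold Rdiv; rewrite Rabs_mult, (Rabs_pos_eq (/ 2)); lra).
      assert (Rabs c <= Rabs y)%R.
      { revert Hc1. unfold Rmin, Rmax, Rabs.
        repeat destruct Rle_dec; repeat destruct Rcase_abs; lra. }
      nra. }
    rewrite <- (pow2_abs y). pose proof (Rabs_pos y). nra.
Qed.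

Lemma Cexp_plus (v w : C) : Cexp (v + w) = Cexp v * Cexp w.
Proof.
  destruct v as [a b], w as [c d]. unfold Cexp, Re, Im, Cplus, Cmult; simpl.
  rewrite exp_plus, cos_plus, sin_plus. f_equal; ring.
Qed.

Lemma Cmod_le_Re_Im (w : C) : (Cmod w <= Rabs (Re w) + Rabs (Im w))%R.
Proof.
  pose proof (Rabs_pos (Re w)). pose proof (Rabs_pos (Im w)).
  apply Rsqr_incr_0_var; [|lra]. unfold Rsqr.
  replace (Cmod w * Cmod w)%R with (Cmod w ^ 2)%R by ring.
  rewrite Cmod2_alt, <- (pow2_abs (Re w)), <- (pow2_abs (Im w)). nra.
Qed.

Lemma Rabs_Im_le_Cmod (w : C) : (Rabs (Im w) <= Cmod w)%R.
Proof.
  eapply Rle_trans; [apply Rmax_r|apply Rmax_Cmod].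
Qed.

Lemma Cexp_taylor1 (w : C) :
  (Cmod (Cexp w - 1 - w) <= 4 * Cmod w ^ 2 * exp (Cmod w))%R.
Proof.
  destruct w as [x y].
  pose proof (re_le_Cmod (x, y)) as Hx. pose proof (Rabs_Im_le_Cmod (x, y)) as Hy.
  pose proof (Cmod2_alt (x, y)) as HM. simpl Re in *; simpl Im in *.
  set (M := Cmod (x, y)) in *.
  eapply Rle_trans; [apply Cmod_le_Re_Im|]. simpl.
  destruct (exp_taylor1 x) as [E1 E2].
  pose proof (exp_minus_1_bound x) as E3.
  destruct (cos_taylor y) as [T1 T2]. pose proof (sin_taylor y) as T3.
  assert (EM : (exp (Rabs x) <= exp M)%R) by (apply exp_mono; exact Hx).
  assert (EX : (exp x <= exp M)%R)
    by (apply exp_mono; eapply Rle_trans; [apply Rle_abs|exact Hx]).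
  pose proof (exp_pos x) as Px. pose proof (exp_pos (Rabs x)) as Pax.
  assert (PM : (1 <= exp M)%R)
    by (pose proof (exp_ineq1_le M); pose proof (Rabs_pos x); lra).
  assert (A1 : (Rabs (exp x * cos y + - (1) + - x)
                 <= y ^ 2 * exp M + x ^ 2 * exp M)%R).
  { replace (exp x * cos y + - (1) + - x)%R
      with (- (exp x * (1 - cos y)) + (exp x - 1 - x))%R by ring.
    eapply Rle_trans; [apply Rabs_triang|].
    rewrite Rabs_Ropp, Rabs_pos_eq by nra.
    rewrite (Rabs_pos_eq (exp x - 1 - x)) by lra. nra. }
  assert (A2 : (Rabs (exp x * sin y + - 0 + - y)
                 <= y ^ 2 * exp M + Rabs x * Rabs y * exp M)%R).
  { replace (exp x * sin y + - 0 + - y)%R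
      with (exp x * (sin y - y) + y * (exp x - 1))%R by ring.
    eapply Rle_trans; [apply Rabs_triang|].
    rewrite !Rabs_mult, (Rabs_pos_eq (exp x)) by lra.
    pose proof (Rabs_pos y). pose proof (Rabs_pos x).
    pose proof (Rabs_pos (sin y - y)). pose proof (pow2_ge_0 y).
    apply Rplus_le_compat.
    - rewrite Rmult_comm. apply Rmult_le_compat; lra.
    - rewrite (Rmult_comm (Rabs x)), Rmult_assoc.
      apply Rmult_le_compat_l; [lra|]. eapply Rle_trans; [exact E3|].
      apply Rmult_le_compat_l; lra. }
  pose proof (pow2_ge_0 y). pose proof (pow2_ge_0 x).
  rewrite <- (pow2_abs x), <- (pow2_abs y) in *.
  assert (Rabs x * Rabs y <= M ^ 2)%R by nra.
  nra.
Qed.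

Lemma is_lim_seq_inv_INR : is_lim_seq (fun n => / INR n)%R 0%R.
Proof.
  replace (Finite 0) with (Rbar_inv p_infty) by reflexivity.
  apply is_lim_seq_inv; [apply is_lim_seq_INR|discriminate].
Qed.

(** As 1 + t <= exp t, the bound propagates from n to n + 1 as soon as the
    exponent grows by at least K / (n + 1)^2; it grows by
    2 K / ((n + 1) (n + 2)). *)
Lemma bounded_of_ratio (v : nat -> C) (K : R) :
  (0 <= K)%R ->
  (forall n, Cmod (v (S n) - v n) <= K / (INR n + 1) ^ 2 * Cmod (v n))%R ->
  forall n, (Cmod (v n) <= Cmod (v O) * exp (K * (2 - 2 / (INR n + 1))))%R.
Proof.
  intros HK Hv n. induction n as [|n IH].
  - simpl INR. replace (K * (2 - 2 / (0 + 1)))%R with 0%R by field.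
    rewrite exp_0. lra.
  - pose proof (pos_INR n) as Pn.
    set (x := (INR n + 1)%R) in *. assert (Hx : (0 < x)%R) by (unfold x; lra).
    rewrite S_INR. fold x.
    assert (Q : (0 <= K / x ^ 2)%R).
    { apply Rmult_le_pos; [exact HK|]. left. apply Rinv_0_lt_compat. nra. }
    replace (v (S n)) with (v n + (v (S n) - v n)) by ring.
    eapply Rle_trans; [apply Cmod_triangle|].
    pose proof (Hv n) as Hvn. fold x in Hvn.
    apply Rle_trans with ((1 + K / x ^ 2) * Cmod (v n))%R; [lra|].
    replace (K * (2 - 2 / (x + 1)))%R
      with (2 * K / (x * (x + 1)) + K * (2 - 2 / x))%R by (field; lra).
    rewrite exp_plus.
    (* what is needed is K / x^2 <= 2 K / (x (x + 1)), which is x >= 1 *)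
    replace (Cmod (v O) * _)%R
      with (exp (2 * K / (x * (x + 1))) * (Cmod (v O) * exp (K * (2 - 2 / x))))%R
      by ring.
    apply Rmult_le_compat; [lra|apply Cmod_ge_0| |exact IH].
    eapply Rle_trans; [|apply exp_ineq1_le].
    apply Rplus_le_compat_l.
    replace (2 * K / (x * (x + 1)) - 0)%R with (2 * K / (x * (x + 1)))%R by ring.
    assert (E : (2 * K / (x * (x + 1)) - K / x ^ 2
                 = K * ((x - 1) / (x ^ 2 * (x + 1))))%R) by (field; lra).
    assert (0 <= K * ((x - 1) / (x ^ 2 * (x + 1))))%R; [|lra].
    apply Rmult_le_pos; [exact HK|]. apply Rmult_le_pos; [unfold x; lra|].
    left. apply Rinv_0_lt_compat. apply Rmult_lt_0_compat; nra.
Qed.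

(** Adding the correction 2 K / (n + 1), which decreases at each step by at
    least as much as the sequence can grow, turns the sequence into a
    decreasing one that is bounded below. *)
Lemma ex_finite_lim_of_increments (a : nat -> R) (K B : R) :
  (0 <= K)%R ->
  (forall n, Rabs (a (S n) - a n) <= K / (INR n + 1) ^ 2)%R ->
  (forall n, Rabs (a n) <= B)%R ->
  ex_finite_lim_seq a.
Proof.
  intros HK Ha HB.
  assert (L0 : is_lim_seq (fun n => 2 * K * / (INR n + 1))%R (2 * K * 0)%R).
  { apply is_lim_seq_mult'; [apply is_lim_seq_const|].
    apply is_lim_seq_ext with (fun n => / INR (S n))%R;
      [intros n; now rewrite S_INR|].
    apply (is_lim_seq_incr_1 (fun n => / INR n)%R), is_lim_seq_inv_INR. }
  destruct (ex_finite_lim_seq_decr (fun n => a n + 2 * K * / (INR n + 1))%R (- B))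
    as [l Hl].
  - intros n. pose proof (pos_INR n) as Pn. rewrite S_INR.
    pose proof (Ha n) as H. apply Rabs_le_between in H.
    set (x := (INR n + 1)%R) in *. assert (Hx : (1 <= x)%R) by (unfold x; lra).
    assert (E : (2 * K * / x - 2 * K * / (x + 1) - K / x ^ 2
                 = K * ((x - 1) / (x ^ 2 * (x + 1))))%R) by (field; lra).
    assert (0 <= K * ((x - 1) / (x ^ 2 * (x + 1))))%R; [|lra].
    apply Rmult_le_pos; [exact HK|]. apply Rmult_le_pos; [lra|].
    left. apply Rinv_0_lt_compat. apply Rmult_lt_0_compat; nra.
  - intros n. pose proof (HB n) as H. apply Rabs_le_between in H.
    assert (0 <= 2 * K * / (INR n + 1))%R; [|lra].
    apply Rmult_le_pos; [lra|]. left. apply Rinv_0_lt_compat.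
    pose proof (pos_INR n). lra.
  - exists (l - 2 * K * 0)%R.
    apply is_lim_seq_ext
      with (fun n => (a n + 2 * K * / (INR n + 1)) - 2 * K * / (INR n + 1))%R;
      [intros n; ring|].
    now apply is_lim_seq_minus'.
Qed.

(** Convergence is taken componentwise, as in [Clim_seq]. *)
Definition Ccv (u : nat -> C) (l : C) : Prop :=
  is_lim_seq (fun n => Re (u n)) (Re l) /\ is_lim_seq (fun n => Im (u n)) (Im l).

Lemma Ccv_Clim_seq (u : nat -> C) (l : C) : Ccv u l -> Clim_seq u = l.
Proof.
  intros [H1 H2]. unfold Clim_seq.
  rewrite (is_lim_seq_unique _ _ H1), (is_lim_seq_unique _ _ H2).
  now destruct l.
Qed.

Lemma Ccv_unique (u : nat -> C) (l m : C) : Ccv u l -> Ccv u m -> l = m.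
Proof. intros H1 H2. rewrite <- (Ccv_Clim_seq u l H1). now apply Ccv_Clim_seq. Qed.

Lemma Ccv_const (c : C) : Ccv (fun _ => c) c.
Proof. split; apply is_lim_seq_const. Qed.

Lemma Ccv_plus (u v : nat -> C) (l m : C) :
  Ccv u l -> Ccv v m -> Ccv (fun n => u n + v n) (l + m).
Proof. intros [H1 H2] [H3 H4]. split; simpl; now apply is_lim_seq_plus'. Qed.

Lemma Ccv_mult (u v : nat -> C) (l m : C) :
  Ccv u l -> Ccv v m -> Ccv (fun n => u n * v n) (l * m).
Proof.
  intros [H1 H2] [H3 H4]. split; simpl.
  - apply is_lim_seq_minus'; now apply is_lim_seq_mult'.
  - apply is_lim_seq_plus'; now apply is_lim_seq_mult'.
Qed.

Lemma Ccv_incr (u : nat -> C) (l : C) : Ccv (fun n => u (S n)) l <-> Ccv u l.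
Proof.
  unfold Ccv.
  rewrite (is_lim_seq_incr_1 (fun n => Re (u n))).
  rewrite (is_lim_seq_incr_1 (fun n => Im (u n))). reflexivity.
Qed.

Lemma Ccv_ext (u v : nat -> C) (l : C) :
  (forall n, u n = v n) -> Ccv u l -> Ccv v l.
Proof.
  intros E [H1 H2].
  split; [eapply is_lim_seq_ext; [|exact H1]|eapply is_lim_seq_ext; [|exact H2]];
    intros n; cbv beta; now rewrite E.
Qed.

(** The convergence half of the theory of infinite products with factors
    1 + O(1/n^2): the partial products are bounded, so that their increments
    are O(1/n^2) too. *)
Lemma Ccv_ratio (v : nat -> C) (K : R) :
  (0 <= K)%R ->
  (forall n, Cmod (v (S n) - v n) <= K / (INR n + 1) ^ 2 * Cmod (v n))%R ->
  exists l, Ccv v l.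
Proof.
  intros HK Hv.
  set (B := (Cmod (v O) * exp (2 * K))%R).
  assert (HB : forall n, (Cmod (v n) <= B)%R).
  { intros n. eapply Rle_trans; [now apply bounded_of_ratio with (K := K)|].
    apply Rmult_le_compat_l; [apply Cmod_ge_0|]. apply exp_mono.
    assert (0 < 2 / (INR n + 1))%R
      by (pose proof (pos_INR n); apply Rdiv_lt_0_compat; lra).
    nra. }
  assert (HD : forall n, (Cmod (v (S n) - v n) <= K * B / (INR n + 1) ^ 2)%R).
  { intros n. eapply Rle_trans; [apply Hv|].
    replace (K * B / (INR n + 1) ^ 2)%R with (K / (INR n + 1) ^ 2 * B)%R
      by (unfold Rdiv; ring).
    apply Rmult_le_compat_l; [|apply HB].
    apply Rmult_le_pos; [exact HK|]. left. apply Rinv_0_lt_compat.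
    pose proof (pos_INR n). nra. }
  assert (PB : (0 <= K * B)%R).
  { apply Rmult_le_pos; [exact HK|].
    eapply Rle_trans; [apply Cmod_ge_0|apply (HB O)]. }
  destruct (ex_finite_lim_of_increments (fun n => Re (v n)) (K * B) B PB)
    as [x Hx].
  - intros n. eapply Rle_trans; [|apply HD]. eapply Rle_trans; [|apply re_le_Cmod].
    simpl. apply Req_le. reflexivity.
  - intros n. eapply Rle_trans; [apply re_le_Cmod|apply HB].
  - destruct (ex_finite_lim_of_increments (fun n => Im (v n)) (K * B) B PB)
      as [y Hy].
    + intros n. eapply Rle_trans; [|apply HD].
      eapply Rle_trans; [|apply Rabs_Im_le_Cmod].
      simpl. apply Req_le. reflexivity.
    + intros n. eapply Rle_trans; [apply Rabs_Im_le_Cmod|apply HB].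
    + exists (x, y). now split.
Qed.

Definition gauss (z : C) (n : nat) : C :=
  Cpoch z (S n) / INR (fact n) * Cexp (- z * ln (INR n)).

Lemma RtoC_INR_S_neq0 (n : nat) : RtoC (INR (S n)) <> 0.
Proof. intros H. apply RtoC_inj in H. now apply (not_0_INR (S n)). Qed.

Lemma RtoC_fact_neq0 (n : nat) : RtoC (INR (fact n)) <> 0.
Proof. intros H. apply RtoC_inj in H. now apply (INR_fact_neq_0 n). Qed.

Lemma gauss_S (z : C) (n : nat) :
  gauss z (S (S n))
  = gauss z (S n) * ((1 + z / INR (S (S n)))
      * Cexp (- z * (ln (INR (S (S n))) - ln (INR (S n))))).
Proof.
  unfold gauss.
  replace (Cpoch z (S (S (S n)))) with (Cpoch z (S (S n)) * (z + INR (S (S n))))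
    by reflexivity.
  rewrite (fact_simpl (S n)), mult_INR, RtoC_mult.
  replace (- z * ln (INR (S (S n))))
    with (- z * ln (INR (S n)) + - z * (ln (INR (S (S n))) - ln (INR (S n))))
    by ring.
  rewrite Cexp_plus. field.
  split; first [apply RtoC_INR_S_neq0 | apply RtoC_fact_neq0].
Qed.

Lemma ln_step (x : R) :
  (0 < x)%R -> (/ (x + 1) <= ln (x + 1) - ln x <= / x)%R.
Proof.
  intros Hx.
  assert (D : forall u v, (0 < u)%R -> (0 < v)%R -> (ln u - ln v <= u / v - 1)%R).
  { intros u v Hu Hv. rewrite <- ln_div by assumption.
    pose proof (exp_ineq1_le (ln (u / v))) as H.
    rewrite exp_ln in H by (now apply Rdiv_lt_0_compat). lra. }
  split.
  - pose proof (D x (x + 1)%R Hx ltac:(lra)).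
    replace (x / (x + 1) - 1)%R with (- / (x + 1))%R in H by (field; lra). lra.
  - pose proof (D (x + 1)%R x ltac:(lra) Hx).
    replace ((x + 1) / x - 1)%R with (/ x)%R in H by (field; lra). lra.
Qed.

(** With t = 1/(x+1), h = ln(x+1) - ln x and w = - z h, the quantity is
      (1 + z t) (e^w - 1 - w) + z (t - h) - z^2 t h,
    and each of the three terms is O(1/x^2), since t <= h <= 1/x. *)
Lemma gauss_ratio_bound (z : C) (x : R) :
  (1 <= x)%R ->
  (Cmod ((1 + z / RtoC (x + 1)) * Cexp (- z * RtoC (ln (x + 1) - ln x)) - 1)
   <= ((1 + Cmod z) * (4 * Cmod z ^ 2 * exp (Cmod z)) + Cmod z + Cmod z ^ 2)
       / x ^ 2)%R.
Proof.
  intros Hx.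
  destruct (ln_step x) as [L1 L2]; [lra|].
  set (h := (ln (x + 1) - ln x)%R) in *.
  set (M := Cmod z). assert (HM : (0 <= M)%R) by apply Cmod_ge_0.
  set (t := (/ (x + 1))%R) in *.
  assert (Ht : (0 < t)%R) by (apply Rinv_0_lt_compat; lra).
  set (s := (/ x)%R) in *.
  assert (Hs : (0 < s)%R) by (apply Rinv_0_lt_compat; lra).
  assert (Hs1 : (s <= 1)%R).
  { unfold s. rewrite <- Rinv_1. apply Rinv_le_contravar; lra. }
  assert (Hst : (s - t <= s ^ 2)%R).
  { unfold s, t. assert (E : (/ x - / (x + 1) = / x * / (x + 1))%R) by (field; lra).
    rewrite E. fold s t. nra. }
  replace (z / RtoC (x + 1)) with (z * RtoC t)
    by (unfold t; rewrite RtoC_inv by lra; reflexivity).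
  set (w := - z * RtoC h).
  replace ((1 + z * RtoC t) * Cexp w - 1)
    with ((1 + z * RtoC t) * (Cexp w - 1 - w)
          + (z * RtoC (t - h) + - (z ^ 2 * RtoC (t * h))))
    by (unfold w; rewrite RtoC_minus, RtoC_mult; ring).
  assert (Hw : (Cmod w <= M * s)%R).
  { unfold w. rewrite Cmod_mult, Cmod_opp, Cmod_R, Rabs_pos_eq by lra.
    apply Rmult_le_compat_l; [exact HM|lra]. }
  assert (P1 : (Cmod (1 + z * RtoC t) <= 1 + M)%R).
  { eapply Rle_trans; [apply Cmod_triangle|].
    rewrite Cmod_1, Cmod_mult, Cmod_R, Rabs_pos_eq by lra. fold M. nra. }
  assert (P2 : (Cmod (Cexp w - 1 - w) <= 4 * M ^ 2 * exp M * s ^ 2)%R).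
  { eapply Rle_trans; [apply Cexp_taylor1|].
    assert (exp (Cmod w) <= exp M)%R by (apply exp_mono; nra).
    assert (Cmod w ^ 2 <= M ^ 2 * s ^ 2)%R
      by (rewrite <- Rpow_mult_distr; apply pow_incr; split; [apply Cmod_ge_0|lra]).
    replace (4 * M ^ 2 * exp M * s ^ 2)%R
      with (4 * (M ^ 2 * s ^ 2) * exp M)%R by ring.
    apply Rmult_le_compat; [| |lra|assumption].
    - pose proof (pow2_ge_0 (Cmod w)). lra.
    - left. apply exp_pos. }
  assert (P3 : (Cmod (z * RtoC (t - h)) <= M * s ^ 2)%R).
  { rewrite Cmod_mult, Cmod_R. apply Rmult_le_compat_l; [exact HM|].
    apply Rabs_le. lra. }
  assert (P4 : (Cmod (- (z ^ 2 * RtoC (t * h))) <= M ^ 2 * s ^ 2)%R).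
  { rewrite Cmod_opp, Cmod_mult, Cmod_pow, Cmod_R.
    apply Rmult_le_compat_l; [apply pow2_ge_0|].
    rewrite Rabs_pos_eq by nra. nra. }
  replace ((_ + M + M ^ 2) / x ^ 2)%R
    with ((1 + M) * (4 * M ^ 2 * exp M * s ^ 2) + (M * s ^ 2 + M ^ 2 * s ^ 2))%R
    by (unfold s; field; lra).
  eapply Rle_trans; [apply Cmod_triangle|]. apply Rplus_le_compat.
  - rewrite Cmod_mult. apply Rmult_le_compat; try apply Cmod_ge_0; assumption.
  - eapply Rle_trans; [apply Cmod_triangle|]. lra.
Qed.

Lemma gauss_cv (z : C) : Ccv (gauss z) (rGamma z).
Proof.
  set (M := Cmod z). assert (HM : (0 <= M)%R) by apply Cmod_ge_0.
  set (K := ((1 + M) * (4 * M ^ 2 * exp M) + M + M ^ 2)%R).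
  assert (HK : (0 <= K)%R).
  { unfold K. pose proof (exp_pos M). pose proof (pow2_ge_0 M).
    assert (0 <= 4 * M ^ 2 * exp M)%R by nra. nra. }
  destruct (Ccv_ratio (fun n => gauss z (S n)) K HK) as [l [Hl1 Hl2]].
  - intros n. rewrite gauss_S.
    match goal with |- (Cmod (?u * ?r - ?u) <= _)%R =>
      replace (u * r - u) with ((r - 1) * u) by ring end.
    rewrite Cmod_mult. apply Rmult_le_compat_r; [apply Cmod_ge_0|].
    rewrite <- RtoC_minus, (S_INR (S n)).
    eapply Rle_trans; [apply gauss_ratio_bound|].
    + rewrite S_INR. pose proof (pos_INR n). lra.
    + rewrite S_INR. apply Req_le. reflexivity.
  - assert (H : Ccv (gauss z) l) by (apply Ccv_incr; now split).
    unfold rGamma. change (fun n => _) with (gauss z).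
    now rewrite (Ccv_Clim_seq _ _ H).
Qed.

Lemma Cprod_ext (f g : nat -> C) (k : nat) :
  (forall j, f j = g j) -> Cprod f k = Cprod g k.
Proof. intros H. induction k as [|k IH]; simpl; [reflexivity|]. now rewrite IH, H. Qed.

Lemma Cprod_shift (f : nat -> C) (k : nat) :
  Cprod f (S k) = f O * Cprod (fun j => f (S j)) k.
Proof.
  induction k as [|k IH]; [simpl; ring|].
  change (Cprod f (S (S k))) with (Cprod f (S k) * f (S k)). rewrite IH. simpl. ring.
Qed.

Lemma Cpoch_S_left (x : C) (k : nat) : Cpoch x (S k) = x * Cpoch (x + 1) k.
Proof.
  unfold Cpoch. rewrite Cprod_shift. f_equal; [change (x + RtoC 0 = x); ring|].
  apply Cprod_ext. intros j. rewrite S_INR, RtoC_plus. ring.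
Qed.

(** Gauss's approximations at z and z + 1 differ by the factor
    z n / (z + n + 1), whose limit is z. *)
Lemma rGamma_shift (z : C) : rGamma z = z * rGamma (z + 1).
Proof.
  apply (Ccv_unique (fun n => gauss z (S n) * (1 + (z + 1) * RtoC (/ INR (S n))))).
  - replace (rGamma z) with (rGamma z * (1 + (z + 1) * RtoC 0)) by ring.
    apply Ccv_mult.
    + apply (Ccv_incr (gauss z)), gauss_cv.
    + apply Ccv_plus; [apply Ccv_const|]. apply Ccv_mult; [apply Ccv_const|].
      split; simpl Re; simpl Im; [|apply is_lim_seq_const].
      apply (is_lim_seq_incr_1 (fun n => / INR n)%R), is_lim_seq_inv_INR.
  - assert (E : forall n, gauss z (S n) * (1 + (z + 1) * RtoC (/ INR (S n)))
                          = z * gauss (z + 1) (S n)).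
    { intros n. unfold gauss.
      replace (Cpoch (z + 1) (S (S n)))
        with (Cpoch (z + 1) (S n) * (z + 1 + INR (S n))) by reflexivity.
      rewrite Cpoch_S_left.
      replace (- (z + 1) * ln (INR (S n)))
        with (- z * ln (INR (S n)) + RtoC (- ln (INR (S n))))
        by (rewrite RtoC_opp; ring).
      rewrite Cexp_plus.
      assert (P : (0 < INR (S n))%R) by (apply lt_0_INR; lia).
      replace (Cexp (RtoC (- ln (INR (S n))))) with (RtoC (/ INR (S n))).
      2:{ unfold Cexp. rewrite re_RtoC, im_RtoC.
          rewrite exp_Ropp, exp_ln, cos_0, sin_0 by exact P.
          unfold RtoC. f_equal; ring. }
      rewrite RtoC_inv by lra. field.
      split; first [apply RtoC_INR_S_neq0 | apply RtoC_fact_neq0]. }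
    apply (Ccv_ext (fun n => z * gauss (z + 1) (S n))); [intros n; now rewrite E|].
    apply Ccv_mult; [apply Ccv_const|]. apply (Ccv_incr (gauss (z + 1))), gauss_cv.
Qed.

(** * The difference equation of the Wilson polynomials *)

(** The basis (b+z)_k (b-z)_k in which Wilson polynomials are expanded. *)
Definition phi (b : C) (k : nat) (z : C) : C :=
  Cprod (fun j => (b + INR j) ^ 2 + - z ^ 2) k.

(** (b+z+1)_m (b-z)_m, the common factor of [phi b (S m)] at z and at z + 1. *)
Definition psi (b : C) (m : nat) (z : C) : C :=
  Cprod (fun j => (b + z + 1 + INR j) * (b - z + INR j)) m.

(** The quotient of phi b k (z + 1) - phi b k z by 2 z + 1, see [dphi_spec]. *)
Definition dphi (b : C) (k : nat) (z : C) : C :=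
  match k with O => 0 | S m => - INR (S m) * psi b m z end.

Lemma Cprod_S (f : nat -> C) (k : nat) : Cprod f (S k) = Cprod f k * f k.
Proof. reflexivity. Qed.

Lemma RtoC_INR_S (k : nat) : RtoC (INR (S k)) = INR k + 1.
Proof. now rewrite S_INR, RtoC_plus. Qed.

Lemma phi_even (b : C) (k : nat) (z : C) : phi b k (- z) = phi b k z.
Proof. apply Cprod_ext. intros j. ring. Qed.

Lemma psi_sym (b : C) (m : nat) (z : C) : psi b m (-1 - z) = psi b m z.
Proof. apply Cprod_ext. intros j. ring. Qed.

Lemma dphi_sym (b : C) (k : nat) (z : C) : dphi b k (-1 - z) = dphi b k z.
Proof. destruct k as [|m]; [reflexivity|]. unfold dphi. now rewrite psi_sym. Qed.

Lemma psi_phi (b : C) (m : nat) (z : C) :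
  (b + z) * psi b m z = (b + z + INR m) * phi b m z.
Proof.
  unfold psi, phi. induction m as [|m IH]; [simpl; ring|].
  rewrite !Cprod_S, Cmult_assoc, IH, RtoC_INR_S. ring.
Qed.

Lemma phi_S_psi (b : C) (m : nat) (z : C) :
  phi b (S m) z = (b + z) * (b - z + INR m) * psi b m z.
Proof.
  replace ((b + z) * (b - z + INR m) * psi b m z)
    with ((b - z + INR m) * ((b + z) * psi b m z)) by ring.
  rewrite psi_phi. unfold phi. rewrite Cprod_S. ring.
Qed.

Lemma dphi_spec (b : C) (k : nat) (z : C) :
  phi b k (z + 1) - phi b k z = (2 * z + 1) * dphi b k z.
Proof.
  destruct k as [|m]; [unfold phi; simpl; ring|].
  unfold dphi. rewrite (phi_S_psi b m z).
  replace (z + 1) with (- (-1 - z)) by ring.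
  rewrite phi_even, phi_S_psi, psi_sym, RtoC_INR_S.
  ring.
Qed.

(** The eigenvalue of the Wilson polynomial of degree k, where sigma is the sum
    of the four parameters. *)
Definition eigen (sigma : C) (k : nat) : C := INR k * (INR k + sigma - 1).

(** The operator is triangular with two diagonals on the basis [phi]. After
    taking out phi b m z, what is left is prod_j (x_j + z) - prod_j (x_j - z)
    with x = (b + m, b2, b3, b4). This is 2 z times a polynomial of degree one
    in z^2, here written in powers of (b + m)^2 - z^2; its constant term is the
    value at z = b + m, where the second product vanishes. *)
Lemma phi_difference (b b2 b3 b4 : C) (m : nat) (z : C) :
  (b + z) * (b2 + z) * (b3 + z) * (b4 + z) * dphi b (S m) z
  - (b - z) * (b2 - z) * (b3 - z) * (b4 - z) * dphi b (S m) (z - 1)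
  = 2 * z * (eigen (b + b2 + b3 + b4) (S m) * phi b (S m) z
      - INR (S m) * ((b + b2 + INR m) * (b + b3 + INR m) * (b + b4 + INR m))
        * phi b m z).
Proof.
  assert (E1 := psi_phi b m z).
  assert (E2 := psi_phi b m (- z)). rewrite phi_even in E2.
  replace (psi b m (- z)) with (psi b m (z - 1)) in E2.
  2:{ rewrite <- (psi_sym b m (z - 1)). f_equal.
      ring. }
  unfold dphi.
  replace (phi b (S m) z) with (phi b m z * ((b + INR m) ^ 2 + - z ^ 2))
    by reflexivity.
  replace ((b + z) * (b2 + z) * (b3 + z) * (b4 + z) * (- INR (S m) * psi b m z)
    - (b - z) * (b2 - z) * (b3 - z) * (b4 - z) * (- INR (S m) * psi b m (z - 1)))
    with (- INR (S m) * ((b2 + z) * (b3 + z) * (b4 + z) * ((b + z) * psi b m z)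
           - (b2 - z) * (b3 - z) * (b4 - z) * ((b + - z) * psi b m (z - 1))))
    by ring.
  rewrite E1, E2. unfold eigen. rewrite RtoC_INR_S. ring.
Qed.

Definition wcoef (n : nat) (b b2 b3 b4 : C) (k : nat) : C :=
  Cpoch (- INR n) k * Cpoch (INR n + b + b2 + b3 + b4 - 1) k / INR (fact k)
  * (Cpoch (b + b2 + INR k) (n - k) * Cpoch (b + b3 + INR k) (n - k)
     * Cpoch (b + b4 + INR k) (n - k)).

(** The recursion that makes the coefficients those of an eigenvector. *)
Lemma wcoef_S (n : nat) (b b2 b3 b4 : C) (k : nat) :
  (k < n)%nat ->
  wcoef n b b2 b3 b4 (S k) * INR (S k)
    * ((b + b2 + INR k) * (b + b3 + INR k) * (b + b4 + INR k))
  = - (eigen (b + b2 + b3 + b4) n - eigen (b + b2 + b3 + b4) k)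
    * wcoef n b b2 b3 b4 k.
Proof.
  intros Hk. unfold wcoef, eigen.
  replace (n - k)%nat with (S (n - S k)) by lia.
  rewrite !(Cpoch_S_left (_ + INR k)).
  replace (Cpoch (- INR n) (S k)) with (Cpoch (- INR n) k * (- INR n + INR k))
    by reflexivity.
  set (c := INR n + b + b2 + b3 + b4 - 1).
  replace (Cpoch c (S k)) with (Cpoch c k * (c + INR k)) by reflexivity.
  unfold c.
  rewrite fact_simpl, mult_INR, RtoC_mult.
  replace (b + b2 + INR (S k)) with (b + b2 + INR k + 1)
    by (rewrite RtoC_INR_S; ring).
  replace (b + b3 + INR (S k)) with (b + b3 + INR k + 1)
    by (rewrite RtoC_INR_S; ring).
  replace (b + b4 + INR (S k)) with (b + b4 + INR k + 1)
    by (rewrite RtoC_INR_S; ring).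
  field. split; first [apply RtoC_INR_S_neq0 | apply RtoC_fact_neq0].
Qed.

Lemma sum_n_Sn (f : nat -> C) (n : nat) : sum_n f (S n) = sum_n f n + f (S n).
Proof. apply (sum_Sn f n). Qed.

(** The Wilson polynomial as a function of z = i s, see [wilson_wil]. *)
Definition wil (n : nat) (b b2 b3 b4 z : C) : C :=
  sum_n (fun k => wcoef n b b2 b3 b4 k * phi b k z) n.

(** The quotient of wil (z + 1) - wil z by 2 z + 1, see [dwil_spec]. *)
Definition dwil (n : nat) (b b2 b3 b4 z : C) : C :=
  sum_n (fun k => wcoef n b b2 b3 b4 k * dphi b k z) n.

Lemma wilson_wil (n : nat) (b b2 b3 b4 z : C) :
  wilson n b b2 b3 b4 (- z ^ 2) = wil n b b2 b3 b4 z.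
Proof.
  unfold wilson, wil. apply sum_n_ext. intros k.
  match goal with |- ?x = ?y => change (@eq C x y) end.
  unfold wcoef, phi. field.
  apply RtoC_fact_neq0.
Qed.

Lemma wil_even (n : nat) (b b2 b3 b4 z : C) :
  wil n b b2 b3 b4 (- z) = wil n b b2 b3 b4 z.
Proof. apply sum_n_ext. intros k. now rewrite phi_even. Qed.

Lemma dwil_sym (n : nat) (b b2 b3 b4 z : C) :
  dwil n b b2 b3 b4 (-1 - z) = dwil n b b2 b3 b4 z.
Proof. apply sum_n_ext. intros k. now rewrite dphi_sym. Qed.

Lemma dwil_spec (n : nat) (b b2 b3 b4 z : C) :
  wil n b b2 b3 b4 (z + 1) - wil n b b2 b3 b4 z
  = (2 * z + 1) * dwil n b b2 b3 b4 z.
Proof.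
  unfold wil, dwil. generalize n at 2 4 6. intros N.
  assert (T : forall k, wcoef n b b2 b3 b4 k * phi b k (z + 1)
      = wcoef n b b2 b3 b4 k * phi b k z
        + (2 * z + 1) * (wcoef n b b2 b3 b4 k * dphi b k z)).
  { intros k. replace (phi b k (z + 1))
      with (phi b k z + (phi b k (z + 1) - phi b k z)) by ring.
    rewrite dphi_spec. ring. }
  induction N as [|N IH].
  - rewrite !sum_O, T. ring.
  - rewrite !sum_n_Sn, T.
    match goal with |- ?a + (?p + ?q) - (?c + ?p) = _ =>
      replace (a + (p + q) - (c + p)) with (a - c + q) by ring end.
    rewrite IH. ring.
Qed.

(** The partial sums of the expansion satisfy the equation up to one boundary
    term, which carries the factor eigen n - eigen N and so disappears for
    N = n. *)
Lemma wil_difference (n : nat) (b b2 b3 b4 z : C) :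
  (b + z) * (b2 + z) * (b3 + z) * (b4 + z) * dwil n b b2 b3 b4 z
  - (b - z) * (b2 - z) * (b3 - z) * (b4 - z) * dwil n b b2 b3 b4 (z - 1)
  = 2 * z * (eigen (b + b2 + b3 + b4) n * wil n b b2 b3 b4 z).
Proof.
  set (sigma := b + b2 + b3 + b4).
  assert (H : forall N, (N <= n)%nat ->
    (b + z) * (b2 + z) * (b3 + z) * (b4 + z)
      * sum_n (fun k => wcoef n b b2 b3 b4 k * dphi b k z) N
    - (b - z) * (b2 - z) * (b3 - z) * (b4 - z)
      * sum_n (fun k => wcoef n b b2 b3 b4 k * dphi b k (z - 1)) N
    = 2 * z * (eigen sigma n * sum_n (fun k => wcoef n b b2 b3 b4 k * phi b k z) N
        - (eigen sigma n - eigen sigma N) * (wcoef n b b2 b3 b4 N * phi b N z))).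
  { induction N as [|N IH]; intros HN.
    - rewrite !sum_O. unfold eigen, dphi. replace (INR 0) with 0%R by reflexivity.
      ring.
    - rewrite !sum_n_Sn.
      match goal with |- ?B * (?s + ?c * ?d) - ?B' * (?s' + ?c * ?d') = _ =>
        replace (B * (s + c * d) - B' * (s' + c * d'))
          with ((B * s - B' * s') + c * (B * d - B' * d')) by ring end.
      rewrite IH by lia. rewrite phi_difference. fold sigma.
      pose proof (wcoef_S n b b2 b3 b4 N ltac:(lia)) as W. fold sigma in W.
      match goal with |- ?p + ?c * (?q * (?e * ?f - ?m * ?r * ?g)) = _ =>
        replace (p + c * (q * (e * f - m * r * g)))
          with (p + q * (c * e * f - (c * m * r) * g)) by ring end.
      rewrite W. ring. }
  unfold dwil, wil. rewrite (H n) by lia. ring.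
Qed.

(** * The Lagrange identity for the Dougall weight *)

Definition rGamma_pair (a : R) (z : C) : C := rGamma (a + z) * rGamma (a - z).

Lemma rGamma_pair_shift (a : R) (z : C) :
  rGamma_pair a (z + 1) * (a + z) = rGamma_pair a z * (a - z - 1).
Proof.
  unfold rGamma_pair.
  rewrite (rGamma_shift (a + z)), (rGamma_shift (a - (z + 1))).
  replace (a + z + 1) with (a + (z + 1)) by ring.
  replace (a - (z + 1) + 1) with (a - z) by ring. ring.
Qed.

(** The factor (b + z) / (Gamma(a + z) Gamma(a - z)), with b = 1 - a, of the
    coefficient G of the self-adjoint form of the difference equation. *)
Definition gfac (a : R) (z : C) : C := (1 - a + z) * rGamma_pair a z.

Lemma gfac_pred (a : R) (z : C) : gfac a (z - 1) = (1 - a - z) * rGamma_pair a z.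
Proof.
  unfold gfac. pose proof (rGamma_pair_shift a (z - 1)) as H.
  replace (z - 1 + 1) with z in H by ring.
  replace ((1 - a + (z - 1)) * rGamma_pair a (z - 1))
    with (- (rGamma_pair a (z - 1) * (a - (z - 1) - 1))) by ring.
  rewrite <- H. ring.
Qed.

Lemma gfac_shift (a : R) (z : C) :
  gfac a (z + 1) * (a + z) = - (2 - a + z) * gfac a z.
Proof.
  unfold gfac.
  replace ((1 - a + (z + 1)) * rGamma_pair a (z + 1) * (a + z))
    with ((1 - a + (z + 1)) * (rGamma_pair a (z + 1) * (a + z))) by ring.
  rewrite rGamma_pair_shift. ring.
Qed.

Lemma gfac_sym (a : R) (z : C) : gfac a (-1 - z) = gfac a z.
Proof.
  replace (-1 - z) with (- z - 1) by ring.
  rewrite gfac_pred. unfold gfac, rGamma_pair.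
  replace (a + - z) with (a - z) by ring. replace (a - - z) with (a + z) by ring.
  ring.
Qed.

Definition gweight (a1 a2 a3 a4 : R) (z : C) : C :=
  gfac a1 z * gfac a2 z * gfac a3 z * gfac a4 z.

Definition casoratian (a1 a2 a3 a4 : R) (k l : nat) (z : C) : C :=
  let Y n := wil n (1 - a1) (1 - a2) (1 - a3) (1 - a4) in
  let D n := dwil n (1 - a1) (1 - a2) (1 - a3) (1 - a4) in
  gweight a1 a2 a3 a4 z * (Y l z * D k z - Y k z * D l z).

(** G and the divided differences are invariant under z -> -1 - z, and the
    increments of Y_k, Y_l from z to z + 1, which are (2 z + 1) times their
    divided differences, cancel in the antisymmetric combination. *)
Lemma casoratian_sym (a1 a2 a3 a4 : R) (k l : nat) (z : C) :
  casoratian a1 a2 a3 a4 k l (-1 - z) = casoratian a1 a2 a3 a4 k l z.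
Proof.
  unfold casoratian, gweight. rewrite !gfac_sym, !dwil_sym.
  replace (-1 - z) with (- (z + 1)) by ring.
  rewrite !wil_even.
  set (b1 := 1 - a1). set (b2 := 1 - a2). set (b3 := 1 - a3). set (b4 := 1 - a4).
  replace (wil k b1 b2 b3 b4 (z + 1))
    with (wil k b1 b2 b3 b4 z + (wil k b1 b2 b3 b4 (z + 1) - wil k b1 b2 b3 b4 z))
    by ring.
  replace (wil l b1 b2 b3 b4 (z + 1))
    with (wil l b1 b2 b3 b4 z + (wil l b1 b2 b3 b4 (z + 1) - wil l b1 b2 b3 b4 z))
    by ring.
  rewrite !dwil_spec. ring.
Qed.

Definition weight (a1 a2 a3 a4 : R) (z : C) : C :=
  z * rGamma_pair a1 z * rGamma_pair a2 z * rGamma_pair a3 z * rGamma_pair a4 z.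

(** Summation by parts: in S(z-1), Y_l(z-1) and Y_k(z-1) may be replaced by
    Y_l(z) and Y_k(z), because the two corrections are both
    (2 z - 1) G(z-1) DY_k(z-1) DY_l(z-1); the difference equation then applies
    to the coefficients of Y_l(z) and Y_k(z). *)
Lemma lagrange_identity (a1 a2 a3 a4 : R) (k l : nat) (z : C) :
  let Y n := wil n (1 - a1) (1 - a2) (1 - a3) (1 - a4) in
  let sigma := (1 - a1) + (1 - a2) + (1 - a3) + (1 - a4) in
  2 * (eigen sigma k - eigen sigma l) * (weight a1 a2 a3 a4 z * Y k z * Y l z)
  = casoratian a1 a2 a3 a4 k l z - casoratian a1 a2 a3 a4 k l (z - 1).
Proof.
  intros Y sigma. unfold Y, sigma. clear Y sigma.
  unfold casoratian, gweight. rewrite !gfac_pred. unfold gfac, weight.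
  set (b1 := 1 - a1). set (b2 := 1 - a2). set (b3 := 1 - a3). set (b4 := 1 - a4).
  set (W := rGamma_pair a1 z * rGamma_pair a2 z * rGamma_pair a3 z
            * rGamma_pair a4 z).
  pose proof (wil_difference k b1 b2 b3 b4 z) as Ek.
  pose proof (wil_difference l b1 b2 b3 b4 z) as El.
  pose proof (dwil_spec k b1 b2 b3 b4 (z - 1)) as Dk.
  pose proof (dwil_spec l b1 b2 b3 b4 (z - 1)) as Dl.
  replace (z - 1 + 1) with z in Dk, Dl by ring.
  replace (wil k b1 b2 b3 b4 (z - 1))
    with (wil k b1 b2 b3 b4 z
          - (wil k b1 b2 b3 b4 z - wil k b1 b2 b3 b4 (z - 1))) by ring.
  replace (wil l b1 b2 b3 b4 (z - 1))
    with (wil l b1 b2 b3 b4 z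
          - (wil l b1 b2 b3 b4 z - wil l b1 b2 b3 b4 (z - 1))) by ring.
  rewrite Dk, Dl.
  transitivity (W * (wil l b1 b2 b3 b4 z
      * (2 * z * (eigen (b1 + b2 + b3 + b4) k * wil k b1 b2 b3 b4 z))
    - wil k b1 b2 b3 b4 z
      * (2 * z * (eigen (b1 + b2 + b3 + b4) l * wil l b1 b2 b3 b4 z)))).
  - unfold W. ring.
  - rewrite <- Ek, <- El. unfold W. ring.
Qed.

(** * Decay of the Casoratian *)

Lemma eventually_INR_gt (M : R) : eventually (fun n => M < INR n)%R.
Proof.
  pose proof is_lim_seq_INR as H. apply is_lim_seq_spec in H. exact (H M).
Qed.

Lemma raabe_quotient (p q x y : R) :
  is_lim_seq (fun n => INR n * (((x + INR n + p) ^ 2 + y ^ 2)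
                                / ((x + INR n + q) ^ 2 + y ^ 2) - 1))%R
             (2 * (p - q))%R.
Proof.
  pose proof is_lim_seq_inv_INR as L.
  apply is_lim_seq_ext_loc with
    (fun n => (2 * (p - q) + (2 * x + p + q) * (p - q) * / INR n)
       / ((1 + (x + q) * / INR n) * (1 + (x + q) * / INR n)
          + (y * / INR n) * (y * / INR n)))%R.
  - eapply filter_imp; [|exact (filter_and _ _ (eventually_INR_gt 0)
                                      (eventually_INR_gt (- x - q)))].
    intros n [H1 H2]. field.
    assert (0 < (x + INR n + q) ^ 2)%R by (apply pow_lt; lra).
    pose proof (pow2_ge_0 y).
    repeat split; nra.
  - replace (Finite (2 * (p - q))) with
      (Finite ((2 * (p - q) + (2 * x + p + q) * (p - q) * 0)
        / ((1 + (x + q) * 0) * (1 + (x + q) * 0) + (y * 0) * (y * 0))))%R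
      by (f_equal; field).
    apply is_lim_seq_div'.
    + apply is_lim_seq_plus'; [apply is_lim_seq_const|].
      apply is_lim_seq_mult'; [apply is_lim_seq_const|exact L].
    + assert (L1 : is_lim_seq (fun n => 1 + (x + q) * / INR n)%R
                              (1 + (x + q) * 0)%R).
      { apply is_lim_seq_plus'; [apply is_lim_seq_const|].
        apply is_lim_seq_mult'; [apply is_lim_seq_const|exact L]. }
      assert (L2 : is_lim_seq (fun n => y * / INR n)%R (y * 0)%R)
        by (apply is_lim_seq_mult'; [apply is_lim_seq_const|exact L]).
      apply is_lim_seq_plus'; now apply is_lim_seq_mult'.
    + lra.
Qed.

Lemma raabe_mult (f g : nat -> R) (l m : R) :
  is_lim_seq (fun n => INR n * (f n - 1))%R l ->
  is_lim_seq (fun n => INR n * (g n - 1))%R m ->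
  is_lim_seq (fun n => INR n * (f n * g n - 1))%R (l + m)%R.
Proof.
  intros Hf Hg.
  assert (G1 : is_lim_seq g 1%R).
  { apply is_lim_seq_ext_loc
      with (fun n => 1 + INR n * (g n - 1) * / INR n)%R.
    - eapply filter_imp; [|exact (eventually_INR_gt 0)]. intros n Hn. field. lra.
    - replace (Finite 1) with (Finite (1 + m * 0)) by (f_equal; ring).
      apply is_lim_seq_plus'; [apply is_lim_seq_const|].
      apply is_lim_seq_mult'; [exact Hg|apply is_lim_seq_inv_INR]. }
  apply is_lim_seq_ext
    with (fun n => INR n * (f n - 1) * g n + INR n * (g n - 1))%R;
    [intros n; ring|].
  replace (l + m)%R with (l * 1 + m)%R by ring.
  apply is_lim_seq_plus'; [|exact Hg]. now apply is_lim_seq_mult'.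
Qed.

(** Raabe's test: eventually rho n <= 1 - M / n, and Bernoulli's inequality
    bounds this by (1 - 1/(n+1))^M = (n / (n+1))^M, so that u n * n^M is
    eventually decreasing. *)
Lemma raabe_bound (u rho : nat -> R) (L : R) (M : nat) :
  (forall n, 0 <= u n)%R ->
  eventually (fun n => u (S n) = rho n * u n)%R ->
  is_lim_seq (fun n => INR n * (rho n - 1))%R L ->
  (L < - INR M)%R ->
  exists K, eventually (fun n => u n * INR n ^ M <= K)%R.
Proof.
  intros Hu Hrec HL HM.
  assert (Hlt : eventually (fun n => INR n * (rho n - 1) < - INR M)%R).
  { apply is_lim_seq_spec in HL.
    assert (P : (0 < - INR M - L)%R) by lra.
    eapply filter_imp; [|exact (HL (mkposreal _ P))]. intros n H. simpl in H.
    apply Rabs_lt_between in H. lra. }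
  destruct (filter_and _ _ Hrec (filter_and _ _ Hlt (eventually_INR_gt (INR M + 1))))
    as [N HN].
  exists (u N * INR N ^ M)%R, N. intros n Hn.
  induction Hn as [|n Hn IH]; [apply Rle_refl|].
  eapply Rle_trans; [|exact IH]. clear IH.
  destruct (HN n Hn) as [E [H1 H2]]. rewrite E, S_INR.
  set (x := INR n) in *. pose proof (pos_INR M) as PM.
  assert (Hx : (0 < x)%R) by lra.
  replace (rho n * u n * (x + 1) ^ M)%R with (u n * (rho n * (x + 1) ^ M))%R
    by ring.
  apply Rmult_le_compat_l; [apply Hu|].
  (* Bernoulli's inequality for the negative number - 1/(x+1) *)
  assert (B : (1 + INR M * - / (x + 1) <= (1 + - / (x + 1)) ^ M)%R).
  { assert (Hy : (0 < / (x + 1) <= 1)%R).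
    { split; [apply Rinv_0_lt_compat; lra|].
      rewrite <- Rinv_1. apply Rinv_le_contravar; lra. }
    clear -Hy. set (y := (- / (x + 1))%R) in *.
    assert (Hy' : (-1 <= y <= 0)%R) by (unfold y; lra). clear Hy.
    induction M as [|M IH]; [simpl; lra|].
    rewrite S_INR. change ((1 + y) ^ S M)%R with ((1 + y) * (1 + y) ^ M)%R.
    pose proof (pos_INR M). nra. }
  assert (R1 : (rho n <= 1 - INR M * / x)%R).
  { apply Rmult_le_reg_l with x; [exact Hx|].
    replace (x * (1 - INR M * / x))%R with (x - INR M)%R by (field; lra). lra. }
  assert (I : (/ (x + 1) <= / x)%R) by (apply Rinv_le_contravar; lra).
  replace (1 + - / (x + 1))%R with (x * / (x + 1))%R in B by (field; lra).
  rewrite Rpow_mult_distr, pow_inv in B.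
  assert (P1 : (0 < (x + 1) ^ M)%R) by (apply pow_lt; lra).
  apply Rle_trans with ((x ^ M * / (x + 1) ^ M) * (x + 1) ^ M)%R.
  - apply Rmult_le_compat_r; [lra|]. nra.
  - apply Req_le. field. lra.
Qed.

(** Squared moduli make the ratio a real rational function of n. The hypothesis
    keeps a + z away from its zero. *)
Lemma gfac_sq_shift (a : R) (alpha : C) (n : nat) :
  (- Re alpha - a < INR n)%R ->
  (Cmod (gfac a (alpha + INR (S n))) ^ 2
   = ((Re alpha + INR n + (2 - a)) ^ 2 + Im alpha ^ 2)
      / ((Re alpha + INR n + a) ^ 2 + Im alpha ^ 2)
     * Cmod (gfac a (alpha + INR n)) ^ 2)%R.
Proof.
  intros Hn.
  pose proof (gfac_shift a (alpha + INR n)) as H.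
  apply (f_equal (fun w => Cmod w ^ 2)%R) in H.
  rewrite !Cmod_mult, Cmod_opp, !Rpow_mult_distr in H.
  rewrite (Cmod2_alt (a + _)), (Cmod2_alt (2 - a + _)) in H.
  replace (alpha + INR n + 1) with (alpha + INR (S n)) in H
    by (rewrite RtoC_INR_S; ring).
  revert H. destruct alpha as [x y]. simpl Re in *. simpl Im in *. intros H.
  assert (P : (0 < (x + INR n + a) ^ 2)%R) by (apply pow_lt; lra).
  pose proof (pow2_ge_0 y).
  apply Rmult_eq_reg_r with ((x + INR n + a) ^ 2 + y ^ 2)%R; [|lra].
  replace ((x + INR n + a) ^ 2 + y ^ 2)%R
    with ((a + (x + INR n)) ^ 2 + (0 + (y + 0)) ^ 2)%R at 1 by ring.
  rewrite H. field. lra.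
Qed.

(** Raabe's test for |G|^2, whose ratio is 1 + sum_j (4 - 4 a_j) / n + o(1/n). *)
Lemma gweight_bound (a1 a2 a3 a4 : R) (alpha : C) (M : nat) :
  (INR M < 2 * (a1 + a2 + a3 + a4) - 8)%R ->
  exists K, eventually
    (fun n => Cmod (gweight a1 a2 a3 a4 (alpha + INR n)) * INR n ^ M <= K)%R.
Proof.
  intros HM.
  set (rho := fun (a : R) (n : nat) =>
    (((Re alpha + INR n + (2 - a)) ^ 2 + Im alpha ^ 2)
      / ((Re alpha + INR n + a) ^ 2 + Im alpha ^ 2))%R).
  destruct (raabe_bound
    (fun n => Cmod (gweight a1 a2 a3 a4 (alpha + INR n)) ^ 2)%R
    (fun n => rho a1 n * rho a2 n * rho a3 n * rho a4 n)%R
    (2 * ((2 - a1) - a1) + 2 * ((2 - a2) - a2) + 2 * ((2 - a3) - a3)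
      + 2 * ((2 - a4) - a4))%R (M * 2)) as [K HK].
  - intros n. apply pow2_ge_0.
  - eapply filter_imp; [|exact (filter_and _ _
      (filter_and _ _ (eventually_INR_gt (- Re alpha - a1))
                                      (eventually_INR_gt (- Re alpha - a2)))
         (filter_and _ _ (eventually_INR_gt (- Re alpha - a3))
                         (eventually_INR_gt (- Re alpha - a4))))].
    intros n [[H1 H2] [H3 H4]]. unfold gweight.
    rewrite !Cmod_mult, !Rpow_mult_distr.
    rewrite !gfac_sq_shift by assumption. unfold rho. ring.
  - apply (raabe_mult (fun n => rho a1 n * rho a2 n * rho a3 n)%R (rho a4));
      [|apply raabe_quotient].
    apply (raabe_mult (fun n => rho a1 n * rho a2 n)%R (rho a3));
      [|apply raabe_quotient].
    apply (raabe_mult (rho a1) (rho a2)); apply raabe_quotient.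
  - rewrite mult_INR. simpl (INR 2). lra.
  - exists (K + 1)%R. eapply filter_imp; [|exact HK]. intros n H.
    cbv beta in H. rewrite pow_mult, <- Rpow_mult_distr in H.
    (* t <= K + 1 because t^2 <= K *)
    set (t := (Cmod (gweight a1 a2 a3 a4 (alpha + INR n)) * INR n ^ M)%R) in *.
    nra.
Qed.

(** The bound starts at n = 1, so that it weakens when the degree grows. *)
Definition poly_bounded (f : nat -> C) (d : nat) : Prop :=
  exists K, (0 <= K)%R /\
    forall n, (1 <= INR n)%R -> (Cmod (f n) <= K * INR n ^ d)%R.

Lemma poly_bounded_weaken (f : nat -> C) (d e : nat) :
  (d <= e)%nat -> poly_bounded f d -> poly_bounded f e.
Proof.
  intros Hde [K [HK H]]. exists K. split; [exact HK|]. intros n Hn.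
  eapply Rle_trans; [now apply H|]. apply Rmult_le_compat_l; [exact HK|].
  now apply Rle_pow.
Qed.

Lemma poly_bounded_const (c : C) : poly_bounded (fun _ => c) 0.
Proof. exists (Cmod c). split; [apply Cmod_ge_0|]. intros n _. simpl. lra. Qed.

Lemma poly_bounded_plus (f g : nat -> C) (d : nat) :
  poly_bounded f d -> poly_bounded g d -> poly_bounded (fun n => f n + g n) d.
Proof.
  intros [K [HK Hf]] [L [HL Hg]]. exists (K + L)%R. split; [lra|]. intros n Hn.
  eapply Rle_trans; [apply Cmod_triangle|].
  specialize (Hf n Hn). specialize (Hg n Hn). lra.
Qed.

Lemma poly_bounded_mult (f g : nat -> C) (d e : nat) :
  poly_bounded f d -> poly_bounded g e ->
  poly_bounded (fun n => f n * g n) (d + e).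
Proof.
  intros [K [HK Hf]] [L [HL Hg]]. exists (K * L)%R.
  split; [now apply Rmult_le_pos|]. intros n Hn.
  rewrite Cmod_mult, pow_add.
  replace (K * L * (INR n ^ d * INR n ^ e))%R
    with ((K * INR n ^ d) * (L * INR n ^ e))%R by ring.
  apply Rmult_le_compat; auto using Cmod_ge_0.
Qed.

Lemma poly_bounded_ext (f g : nat -> C) (d : nat) :
  (forall n, f n = g n) -> poly_bounded f d -> poly_bounded g d.
Proof.
  intros E [K [HK H]]. exists K. split; [exact HK|]. intros n Hn.
  rewrite <- E. now apply H.
Qed.

Lemma poly_bounded_scal (c : C) (f : nat -> C) (d : nat) :
  poly_bounded f d -> poly_bounded (fun n => c * f n) d.
Proof. apply (poly_bounded_mult _ _ 0). apply poly_bounded_const. Qed.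

Lemma poly_bounded_affine (c e : C) : poly_bounded (fun n => c + e * INR n) 1.
Proof.
  apply poly_bounded_plus.
  - apply poly_bounded_weaken with 0%nat; [lia|apply poly_bounded_const].
  - apply poly_bounded_scal. exists 1%R. split; [lra|]. intros n Hn.
    rewrite Cmod_R, Rabs_pos_eq by lra. simpl. lra.
Qed.

Lemma poly_bounded_Cprod (f : nat -> nat -> C) (d k : nat) :
  (forall j, poly_bounded (fun n => f n j) d) ->
  poly_bounded (fun n => Cprod (f n) k) (k * d).
Proof.
  intros H. induction k as [|k IH]; [exact (poly_bounded_const 1)|].
  replace (S k * d)%nat with (k * d + d)%nat by lia.
  apply poly_bounded_mult; [exact IH|apply H].
Qed.

Lemma poly_bounded_sum (f : nat -> nat -> C) (d N : nat) :
  (forall k, (k <= N)%nat -> poly_bounded (fun n => f n k) d) ->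
  poly_bounded (fun n => sum_n (f n) N) d.
Proof.
  intros H. induction N as [|N IH].
  - apply poly_bounded_ext with (fun n => f n O); [|apply H; lia].
    intros n. now rewrite sum_O.
  - apply poly_bounded_ext with (fun n => sum_n (f n) N + f n (S N)).
    + intros n. now rewrite sum_n_Sn.
    + apply poly_bounded_plus; [apply IH; intros k Hk|]; apply H; lia.
Qed.

Lemma poly_bounded_phi (b alpha : C) (k : nat) :
  poly_bounded (fun n => phi b k (alpha + INR n)) (k * 2).
Proof.
  apply poly_bounded_Cprod. intros j.
  apply poly_bounded_ext with
    (fun n => (b + INR j - alpha + (-1) * INR n)
              * (b + INR j + alpha + 1 * INR n)); [intros n; ring|].
  apply (poly_bounded_mult _ _ 1 1); apply poly_bounded_affine.
Qed.

Lemma poly_bounded_dphi (b alpha : C) (k : nat) :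
  poly_bounded (fun n => dphi b k (alpha + INR n)) (k * 2).
Proof.
  destruct k as [|m]; [exact (poly_bounded_const 0)|].
  apply poly_bounded_scal.
  apply poly_bounded_weaken with (m * 2)%nat; [lia|].
  apply poly_bounded_Cprod. intros j.
  apply poly_bounded_ext with
    (fun n => (b + alpha + 1 + INR j + 1 * INR n)
              * (b - alpha + INR j + (-1) * INR n)); [intros n; ring|].
  apply (poly_bounded_mult _ _ 1 1); apply poly_bounded_affine.
Qed.

Lemma poly_bounded_wil (m : nat) (b b2 b3 b4 alpha : C) :
  poly_bounded (fun n => wil m b b2 b3 b4 (alpha + INR n)) (m * 2).
Proof.
  apply poly_bounded_sum. intros k Hk. apply poly_bounded_scal.
  apply poly_bounded_weaken with (k * 2)%nat; [lia|apply poly_bounded_phi].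
Qed.

Lemma poly_bounded_dwil (m : nat) (b b2 b3 b4 alpha : C) :
  poly_bounded (fun n => dwil m b b2 b3 b4 (alpha + INR n)) (m * 2).
Proof.
  apply poly_bounded_sum. intros k Hk. apply poly_bounded_scal.
  apply poly_bounded_weaken with (k * 2)%nat; [lia|apply poly_bounded_dphi].
Qed.

Lemma casoratian_lim (a1 a2 a3 a4 : R) (alpha : C) (k l : nat) :
  (INR (2 * k + 2 * l + 1) < 2 * (a1 + a2 + a3 + a4) - 8)%R ->
  is_lim_seq (fun n => Cmod (casoratian a1 a2 a3 a4 k l (alpha + INR n))) 0%R.
Proof.
  intros HM.
  destruct (gweight_bound a1 a2 a3 a4 alpha _ HM) as [K HK].
  set (b1 := 1 - a1). set (b2 := 1 - a2). set (b3 := 1 - a3). set (b4 := 1 - a4).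
  assert (P : poly_bounded (fun n =>
      wil l b1 b2 b3 b4 (alpha + INR n) * dwil k b1 b2 b3 b4 (alpha + INR n)
      + (-1) * (wil k b1 b2 b3 b4 (alpha + INR n)
                * dwil l b1 b2 b3 b4 (alpha + INR n))) (2 * k + 2 * l)).
  { apply poly_bounded_plus; [|apply poly_bounded_scal].
    - replace (2 * k + 2 * l)%nat with (l * 2 + k * 2)%nat by lia.
      apply poly_bounded_mult; [apply poly_bounded_wil|apply poly_bounded_dwil].
    - replace (2 * k + 2 * l)%nat with (k * 2 + l * 2)%nat by lia.
      apply poly_bounded_mult; [apply poly_bounded_wil|apply poly_bounded_dwil]. }
  destruct P as [L [HL P]].
  apply is_lim_seq_le_le_loc with (fun _ => 0%R) (fun n => K * L * / INR n)%R.
  - eapply filter_imp; [|exact (filter_and _ _ HK (eventually_INR_gt 1))].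
    intros n [H1 H2]. split; [apply Cmod_ge_0|].
    specialize (P n ltac:(lra)). unfold casoratian. cbv zeta.
    fold b1 b2 b3 b4.
    match goal with |- (Cmod (?g * (?u - ?v)) <= _)%R =>
      replace (u - v) with (u + (-1) * v) by ring end.
    rewrite Cmod_mult.
    eapply Rle_trans; [apply Rmult_le_compat_l; [apply Cmod_ge_0|exact P]|].
    set (W := Cmod (gweight a1 a2 a3 a4 (alpha + INR n))) in *.
    cbv beta in H1. rewrite pow_add, pow_1 in H1.
    replace (W * (L * INR n ^ (2 * k + 2 * l)))%R
      with (W * (INR n ^ (2 * k + 2 * l) * INR n) * (L * / INR n))%R
      by (field; lra).
    rewrite (Rmult_assoc K L).
    apply Rmult_le_compat_r; [|exact H1].
    apply Rmult_le_pos; [exact HL|]. left. apply Rinv_0_lt_compat. lra.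
  - apply is_lim_seq_const.
  - replace (Finite 0) with (Finite (K * L * 0)) by (f_equal; ring).
    apply is_lim_seq_mult'; [apply is_lim_seq_const|apply is_lim_seq_inv_INR].
Qed.

(** * Summation of the telescoping series *)

Lemma is_series_of_remainder (f r : nat -> C) (l : C) :
  (forall N, sum_n f N = l + r N) ->
  is_lim_seq (fun N => Cmod (r N)) 0%R ->
  is_series f l.
Proof.
  intros E H. apply filterlim_locally. intros eps.
  apply is_lim_seq_spec in H.
  eapply filter_imp; [|exact (H eps)]. intros N HN.
  apply C_NormedModule_mixin_compat1.
  change (Cmod (sum_n f N - l) < eps)%R.
  rewrite E. replace (l + r N - l) with (r N) by ring.
  cbv beta in HN. rewrite Rminus_0_r, Rabs_pos_eq in HN by apply Cmod_ge_0. exact HN.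
Qed.

Lemma eigen_diff (sigma : C) (k l : nat) :
  eigen sigma k - eigen sigma l
  = (INR k - INR l) * (INR k + INR l + sigma - 1).
Proof. unfold eigen. ring. Qed.

Lemma dougall_weightE (a1 a2 a3 a4 : R) (alpha : C) (n : Z) :
  dougall_weight a1 a2 a3 a4 alpha n = weight a1 a2 a3 a4 (alpha + IZR n).
Proof. unfold dougall_weight, weight, rGamma_pair. ring. Qed.

(** Sums over a normed module state equalities in the carrier of that structure;
    [field] expects them in C. *)
Ltac field_C := match goal with |- ?x = ?y => change (@eq C x y) end; field.

Theorem mainTheorem3 (a1 a2 a3 a4 : R) (alpha : C) (k l : nat) :
  k <> l ->
  (4 * INR k < a1 + a2 + a3 + a4 - 3)%R ->
  (4 * INR l < a1 + a2 + a3 + a4 - 3)%R ->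
  is_bilateral_series
    (fun n : Z =>
       dougall_weight a1 a2 a3 a4 alpha n
       * wilson k (1 - a1) (1 - a2) (1 - a3) (1 - a4) (- (alpha + IZR n) ^ 2)
       * wilson l (1 - a1) (1 - a2) (1 - a3) (1 - a4) (- (alpha + IZR n) ^ 2))
    0.
Proof.
  intros Hkl Hk Hl.
  set (A := (a1 + a2 + a3 + a4)%R) in *.
  pose proof (pos_INR k) as Pk. pose proof (pos_INR l) as Pl.
  assert (HA : (7 < A)%R).
  { (* the larger of k and l is at least 1 *)
    assert (D : (1 <= k \/ 1 <= l)%nat) by lia.
    destruct D as [D|D]; apply le_INR in D; simpl in D; lra. }
  set (sigma := (1 - a1) + (1 - a2) + (1 - a3) + (1 - a4)).
  set (mu := 2 * (eigen sigma k - eigen sigma l)).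
  assert (Hmu : mu <> 0).
  { assert (E : mu = RtoC (2 * ((INR k - INR l) * (INR k + INR l + 3 - A)))).
    { unfold mu. rewrite eigen_diff. unfold sigma, A.
      rewrite !RtoC_mult, !RtoC_minus, !RtoC_plus. ring. }
    rewrite E. intros H. apply RtoC_inj in H.
    assert (H1 : (INR k - INR l <> 0)%R)
      by (intros H1; apply Hkl, INR_eq; lra).
    assert (H2 : (INR k + INR l + 3 - A <> 0)%R) by lra.
    revert H. repeat apply Rmult_integral_contrapositive_currified; lra. }
  set (Cas := casoratian a1 a2 a3 a4 k l).
  assert (HCas : forall beta, is_lim_seq (fun n => Cmod (Cas (beta + INR n))) 0%R).
  { intros beta. apply casoratian_lim. fold A.
    rewrite !plus_INR, !mult_INR. simpl (INR 2). simpl (INR 1). lra. }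
  assert (Cas_sym : forall z, Cas (-1 - z) = Cas z)
    by (intros z; apply casoratian_sym).
  set (f := fun n : Z => _ : C).
  assert (Hf : forall n, f n = (Cas (alpha + IZR n) - Cas (alpha + IZR n - 1)) / mu).
  { intros n.
    pose proof (lagrange_identity a1 a2 a3 a4 k l (alpha + IZR n)) as E.
    cbv zeta in E. fold sigma mu Cas in E. rewrite <- E.
    unfold f. rewrite dougall_weightE, !wilson_wil. field. exact Hmu. }
  assert (HCasmu : forall beta,
    is_lim_seq (fun n => Cmod (Cas (beta + INR (S n)) / mu)) 0%R).
  { intros beta.
    apply is_lim_seq_ext
      with (fun n => Cmod (Cas (beta + INR (S n))%C) * / Cmod mu)%R;
      [intros n; now rewrite Cmod_div|].
    replace (Finite 0) with (Finite (0 * / Cmod mu)) by (f_equal; ring).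
    apply is_lim_seq_mult'; [|apply is_lim_seq_const].
    apply (is_lim_seq_incr_1 (fun n => Cmod (Cas (beta + INR n)))), HCas. }
  (* the sums over n >= 0 and n < 0 telescope to opposite values at the cut *)
  exists (- Cas (alpha - 1) / mu), (Cas (alpha - 1) / mu). repeat split.
  - apply is_series_of_remainder with (fun N => Cas (alpha - 1 + INR (S N)) / mu);
      [|apply HCasmu].
    induction N as [|N IH].
    + rewrite sum_O, Hf. rewrite RtoC_INR_S. simpl (INR 0). simpl (Z.of_nat 0).
      replace (alpha + RtoC 0) with alpha by ring.
      replace (alpha - 1 + (RtoC 0 + 1)) with alpha by ring. field_C. exact Hmu.
    + rewrite sum_n_Sn, IH, Hf, <- INR_IZR_INZ.
      rewrite (RtoC_INR_S (S N)).
      replace (alpha - 1 + (INR (S N) + 1))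
        with (alpha + INR (S N)) by ring.
      replace (alpha + INR (S N) - 1)
        with (alpha - 1 + INR (S N)) by ring.
      field_C. exact Hmu.
  - assert (Hneg : forall N, sum_n (fun n : nat => f (- Z.of_nat (S n))%Z) N
      = Cas (alpha - 1) / mu + - (Cas (- alpha + INR (S N)) / mu)).
    { induction N as [|N IH].
      - rewrite sum_O, Hf. rewrite RtoC_INR_S. simpl (INR 0).
        change (IZR (- Z.of_nat 1)) with (-1)%R.
        replace (- alpha + (RtoC 0 + 1)) with (-1 - (alpha - 1 - 1)) by ring.
        rewrite Cas_sym.
        replace (alpha + RtoC (-1)) with (alpha - 1) by ring.
        field_C. exact Hmu.
      - rewrite sum_n_Sn, IH, Hf, opp_IZR, <- INR_IZR_INZ, RtoC_opp.
        rewrite !(RtoC_INR_S (S N)).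
        replace (- alpha + INR (S N))
          with (-1 - (alpha + - (INR (S N) + 1))) by ring.
        replace (- alpha + (INR (S N) + 1))
          with (-1 - (alpha + - (INR (S N) + 1) - 1)) by ring.
        rewrite !Cas_sym. field_C. exact Hmu. }
    apply is_series_of_remainder with (1 := Hneg).
    apply is_lim_seq_ext with (2 := HCasmu (- alpha)).
    intros n. now rewrite Cmod_opp.
  - field_C. exact Hmu.
Qed.
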